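(* Let $\theta_{n+1}=\theta_n-\alpha_n(\nabla f(\theta_n)+w_n)$, $n\ge 0$, be the stochastic gradient recursion described in the context, and let $\Lambda=\{\sup_{n\ge 0}\|\theta_n\|<\infty\}$. Suppose that: (i) $\lim_{n\to\infty}\alpha_n=0$ and $\sum_{n=0}^\infty\alpha_n=\infty$; (ii) there exists a real number $r\in(0,\infty)$ such that $w=\limsup_{n\to\infty}\max_{n\le k<a(n,1)}\left\|\sum_{i=n}^k\alpha_i\gamma_i^r w_i\right\|<\infty$ w.p.1 on $\Lambda$; (iii) for any compact set $Q\subset\mathbb{R}^{d_\theta}$ and any $a\in f(Q)$, there exist real numbers $\delta_{Q,a}\in(0,1)$, $\mu_{Q,a}\in(1,2]$, $M_{Q,a}\in[1,\infty)$ such that $|f(\theta)-a|\le M_{Q,a}\|\nabla f(\theta)\|^{\mu_{Q,a}}$ for all $\theta\in Q$ satisfying $|f(\theta)-a|\le\delta_{Q,a}$. Then $\lim_{n\to\infty}\nabla f(\theta_n)=0$ and $\lim_{n\to\infty}f(\theta_n)=\hat f$ w.p.1 on $\Lambda$, where $\hat f=\liminf_{n\to\infty}f(\theta_n)$.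
   Context: $f:\mathbb{R}^{d_\theta}\to\mathbb{R}$ is a differentiable function whose gradient $\nabla f$ is locally Lipschitz continuous. $\{\alpha_n\}_{n\ge 0}$ is a sequence of positive real numbers. On a probability space $(\Omega,\mathcal{F},P)$, $\theta_0$ is an $\mathbb{R}^{d_\theta}$-valued random variable and $\{w_n\}_{n\ge 0}$ is an $\mathbb{R}^{d_\theta}$-valued stochastic process (for each $n$, $w_n$ may be a random function of $\theta_0,\dots,\theta_n$). $\|\cdot\|$ is the Euclidean norm. $\gamma_0=0$ and $\gamma_n=\sum_{i=0}^{n-1}\alpha_i$ for $n\ge 1$. For $t\in(0,\infty)$ and $n\ge 0$, $a(n,t)=\max\{k\ge n:\gamma_k-\gamma_n\le t\}$. ''W.p.1 on an event $A$'' means for all $\omega\in A$ outside a set of probability zero. *)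

(* Defs.v *)
From HB Require Import structures.
From mathcomp Require Import all_boot all_order all_algebra.
From mathcomp Require Import all_classical all_reals all_analysis.
Import Order.TTheory GRing.Theory Num.Theory.
Import numFieldNormedType.Exports.

Set Implicit Arguments.
Unset Strict Implicit.
Unset Printing Implicit Defensive.

Local Open Scope classical_set_scope.
Local Open Scope ring_scope.

(* R^d is 'rV[R]_d. The library norm on 'rV[R]_d is the sup norm, hence a
   separate Euclidean norm. Topological notions (convergence, compactness,
   neighbourhoods, differentiability, local Lipschitz continuity) are those of
   the library, and do not depend on which of the two norms is used. *)
Definition enorm (R : realType) (d : nat) (x : 'rV[R]_d) : R :=
  Num.sqrt (\sum_(i < d) x ord0 i ^+ 2).

Definition gradient (R : realType) (d : nat) (f : 'rV[R]_d -> R)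
    (x : 'rV[R]_d) : 'rV[R]_d :=
  \row_(i < d) 'D_(delta_mx ord0 i) f x.

Definition locally_lipschitz (R : realType) (d e : nat)
    (g : 'rV[R]_d -> 'rV[R]_e) : Prop :=
  forall x : 'rV[R]_d, exists2 U, nbhs x U & [lipschitz g y | y in U].

(* Measurability with respect to the Borel sigma-algebra of R^d. *)
Definition random_vector (R : realType) (d : nat) (disp : measure_display)
    (Omega : measurableType disp) (X : Omega -> 'rV[R]_d) : Prop :=
  measurable_fun [set: Omega]
    (X : Omega -> g_sigma_algebraType (@open 'rV[R]_d)).

Definition gamma (R : realType) (alpha : nat -> R) (n : nat) : R :=
  \sum_(0 <= i < n) alpha i.

Definition in_window (R : realType) (alpha : nat -> R) (n : nat) (t : R)
    (k : nat) : Prop :=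
  (n <= k)%N /\ gamma alpha k - gamma alpha n <= t.

(* max {k >= n | gamma_k - gamma_n <= t}. This maximum exists for all t > 0 and
   n as soon as the step sizes are positive with divergent sum; otherwise the
   value may be the default n. *)
Definition a_index (R : realType) (alpha : nat -> R) (n : nat) (t : R) : nat :=
  xget n [set k | in_window alpha n t k /\
                  forall j, in_window alpha n t j -> (j <= k)%N].

(* The maximum over n <= k < a(n,1) of the norms of the weighted noise sums. An
   empty range (possible only while alpha_n > 1) yields 0; otherwise the initial
   value 0 is harmless because all the terms are nonnegative. *)
Definition noise_max (R : realType) (d : nat) (alpha : nat -> R) (r : R)
    (w : nat -> 'rV[R]_d) (n : nat) : R :=
  \big[Num.max/0]_(n <= k < a_index alpha n 1)
    enorm (\sum_(n <= i < k.+1) (alpha i * (gamma alpha i `^ r)) *: w i).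

(* Main.v *)
Require Import Defs.
From HB Require Import structures.
From mathcomp Require Import all_boot all_order all_algebra.
From mathcomp Require Import all_classical all_reals all_analysis.
From mathcomp Require Import ring lra.
Import Order.TTheory GRing.Theory Num.Theory.
Import numFieldNormedType.Exports.

Local Open Scope classical_set_scope.
Local Open Scope ring_scope.

Set Implicit Arguments.
Unset Strict Implicit.
Unset Printing Implicit Defensive.

(** The argument is pathwise and deterministic: for omega in Lambda outside a
    null set, the trajectory is a bounded sequence x with
    x (n+1) = x n - alpha n (grad f (x n) + w n), and the weighted noise sums
    over windows of length 1 in the time scale gamma are bounded.

    Noise. Summation by parts against the decreasing weights gamma_i^(-r) turns
    that bound into one of order gamma_n^(-r) for the unweighted sums
    \sum alpha_i w_i over a window starting at n. In particular these sums
    vanish as n grows ([noise_window_small]).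

    Descent. On a ball containing the trajectory the gradient is Lipschitz, so
    a Gronwall-type estimate makes x k close to x n - T grad f (x n), where
    T = gamma_k - gamma_n, when T is small; the quadratic upper bound for f then
    gives, for every T below a fixed t,
      f (x k) <= f (x n) - T/2 |grad f (x n)|^2 + o(1)
    ([sgd_window_descent]).

    Convergence of f (x n). Let a be a cluster value of f (x n). The Lojasiewicz
    inequality bounds |grad f| away from 0 on the part of the ball where
    a + eta/2 <= f <= a + eta. In that band f strictly decreases over a window
    of length about t, and one window raises f by o(1) only, too little to jump
    over the band. Since f (x n) is infinitely often below a + eta/2, it
    eventually stays below a + 2 eta ([eventually_below]). Hence no cluster
    value exceeds another one, and a sequence in a compact set with a unique
    cluster value converges.

    Convergence of the gradient. Once f (x n) converges, the descent inequality
    over a window of length at least t/2 forces |grad f (x n)|^2 to 0.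

    The ambient norm is the sup norm; the Euclidean structure enters through the
    inner product [dotv], with |x|^2 <= dotv x x and
    |dotv x y| <= d |x| |y|. *)

(** * Euclidean inner product and sup norm *)

Definition dotv {R : realType} {d : nat} (x y : 'rV[R]_d) : R :=
  \sum_(i < d) x ord0 i * y ord0 i.

Lemma dotvDr (R : realType) (d : nat) (x y z : 'rV[R]_d) :
  dotv x (y + z) = dotv x y + dotv x z.
Proof. by rewrite -big_split; apply: eq_bigr => i _; rewrite mxE mulrDr. Qed.

Lemma dotvZr (R : realType) (d : nat) (a : R) (x y : 'rV[R]_d) :
  dotv x (a *: y) = a * dotv x y.
Proof. by rewrite mulr_sumr; apply: eq_bigr => i _; rewrite mxE mulrCA. Qed.

Lemma dotvBl (R : realType) (d : nat) (x y z : 'rV[R]_d) :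
  dotv (x - y) z = dotv x z - dotv y z.
Proof.
by rewrite -sumrB; apply: eq_bigr => i _; rewrite !mxE mulrBl.
Qed.

Lemma dotv_self_ge0 (R : realType) (d : nat) (x : 'rV[R]_d) : 0 <= dotv x x.
Proof. by apply: sumr_ge0 => i _; rewrite -expr2 sqr_ge0. Qed.

Lemma enorm_sqr (R : realType) (d : nat) (x : 'rV[R]_d) :
  enorm x ^+ 2 = dotv x x.
Proof.
rewrite /enorm sqr_sqrtr; last by apply: sumr_ge0 => i _; rewrite sqr_ge0.
by apply: eq_bigr => i _; rewrite expr2.
Qed.

Lemma rV_norm_le (R : realType) (d : nat) (x : 'rV[R]_d) (c : R) : 0 <= c ->
  (forall i, `|x ord0 i| <= c) -> `|x| <= c.
Proof.
move=> c0 xc; rewrite [leLHS]/Num.norm/= mx_normrE; apply/bigmax_leP; split => //.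
by move=> [i j] _; rewrite (ord1 i).
Qed.

Lemma norm_coord_le (R : realType) (d : nat) (x : 'rV[R]_d) i :
  `|x ord0 i| <= `|x|.
Proof.
rewrite [leRHS]/Num.norm/= mx_normrE.
by apply/bigmax_geP; right; exists (ord0, i).
Qed.

Lemma norm_le_enorm (R : realType) (d : nat) (x : 'rV[R]_d) : `|x| <= enorm x.
Proof.
apply: rV_norm_le => [|i]; first exact: sqrtr_ge0.
rewrite -sqrtr_sqr ler_sqrt; last by apply: sumr_ge0 => j _; rewrite sqr_ge0.
by rewrite (bigD1 i)//= lerDl; apply: sumr_ge0 => j _; rewrite sqr_ge0.
Qed.

Lemma norm_sqr_le_dotv (R : realType) (d : nat) (x : 'rV[R]_d) :
  `|x| ^+ 2 <= dotv x x.
Proof.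
by rewrite -enorm_sqr ler_sqr ?nnegrE ?norm_le_enorm// sqrtr_ge0.
Qed.

Lemma normr_dotv_le (R : realType) (d : nat) (x y : 'rV[R]_d) :
  `|dotv x y| <= d%:R * (`|x| * `|y|).
Proof.
apply: le_trans (ler_norm_sum _ _ _) _.
rewrite mulr_natl -[X in _ *+ X]card_ord -sumr_const.
by apply: ler_sum => i _; rewrite normrM ler_pM// norm_coord_le.
Qed.

(** * Gradient, mean value and Lipschitz bounds *)

Lemma derive_gradient (R : realType) (d : nat) (f : 'rV[R]_d -> R) x v :
  differentiable f x -> 'D_v f x = dotv (gradient f x) v.
Proof.
move=> df; rewrite deriveE// [X in 'd f x X]row_sum_delta linear_sum.
apply: eq_bigr => i _; rewrite linearZ /= mxE -deriveE//.
by rewrite mulrC.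
Qed.

(** The one-variable mean value theorem along the segment from [x] to [x + v]. *)
Lemma gradient_mean_value (R : realType) (d : nat) (f : 'rV[R]_d -> R) x v :
  (forall y, differentiable f y) ->
  exists2 c : R, 0 <= c <= 1 & f (x + v) - f x = dotv (gradient f (x + c *: v)) v.
Proof.
move=> fd.
pose phi (s : R) := f (x + s *: v).
have dphi (s : R) : is_derive s 1 phi (dotv (gradient f (x + s *: v)) v).
  rewrite -derive_gradient//.
  have E : (fun h : R => h^-1 *: (phi (h *: 1 + s) - phi s)) =
           (fun h => h^-1 *: (f (h *: v + (x + s *: v)) - f (x + s *: v))).
    apply/funext => h; rewrite /phi; congr (_ *: (f _ - _)).
    by rewrite scalerDl [h *: 1]mulr1 addrCA.
  apply: DeriveDef.
    rewrite /derivable /= [X in X @ _]E.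
    exact: (diff_derivable (fd _)).
  by rewrite /derive [X in X @ _]E.
have cphi : {within `[0, 1], continuous phi}.
  apply: continuous_subspaceT => s; apply: differentiable_continuous.
  by apply/derivable1_diffP; have := dphi s.
have [c] := MVT_segment ler01 (fun s _ => dphi s) cphi.
rewrite in_itv/= => c01; rewrite subr0 mulr1 /phi scale1r scale0r addr0 => h.
by exists c.
Qed.

(** Near each point, for every large enough L, the function is bounded by L and
    L-Lipschitz at scales below 1/L. Compactness makes one L valid on all of
    [Q]; at scales above 1/L the bound on the values gives the inequality with
    constant 2 L^2. *)
Lemma compact_lipschitz (R : realType) (d e : nat) (g : 'rV[R]_d -> 'rV[R]_e)
  (Q : set 'rV[R]_d) : compact Q -> locally_lipschitz g ->
  exists2 K : R, 0 < K & forall x, Q x -> `|g x| <= K /\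
    forall y, Q y -> `|g x - g y| <= K * `|x - y|.
Proof.
move=> /compact_near_coveringP cQ gl.
have /(_ (fun (L : R) x => `|g x| <= L /\
    forall y, `|x - y| < L^-1 -> `|g x - g y| <= L * `|x - y|) _) :=
  @cQ R (pinfty_nbhs R) _.
case=> [x Qx|M [_ hM]].
  have [U Ux [k [kr lip]]] := gl x.
  have /nbhs_ballP[r /= r0 rU] := Ux.
  pose l := Num.max k 1 + 1.
  have lk : k < l by rewrite /l ltr_pwDr// le_max lexx.
  have l0 : 0 < l by rewrite /l ltr_wpDl// le_max ler01 orbT.
  have lipl a b : U a -> U b -> `|g a - g b| <= l * `|a - b|.
    by move=> Ua Ub; apply: (lip _ lk (a, b)).
  exists (ball x (r / 2), [set L | `|g x| + l * r < L /\ (l < L /\ 2 / r < L)]).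
    split; first by apply: nbhsx_ballx; rewrite divr_gt0.
    by near=> L; split; [|split]; near: L; apply: nbhs_pinfty_gt; apply: num_real.
  move=> [a L] /= [xa [L1 [L2 L3]]].
  have L0 : 0 < L by apply: lt_trans L2.
  have Ux' : U x by apply: rU; exact: ballxx.
  have xa' : `|x - a| < r / 2 by move: xa; rewrite -ball_normE.
  have Ua : U a by apply: rU; rewrite -ball_normE /=; lra.
  split.
    have := lipl _ _ Ua Ux'; rewrite (distrC a) => h1.
    have : l * `|x - a| <= l * r by rewrite ler_wpM2l ?ltW//; lra.
    have := ler_normD (g x) (g a - g x); rewrite addrC subrK; lra.
  move=> y ay.
  have Uy : U y.
    apply: rU; rewrite -ball_normE /=.
    have : L^-1 < r / 2.
      by rewrite -[r / 2]invrK ltf_pV2 ?posrE ?invr_gt0 ?divr_gt0// invf_div.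
    have := ler_distD a x y; lra.
  by apply: le_trans (lipl _ _ Ua Uy) _; rewrite ler_wpM2r// ltW.
pose L := Num.max M 1 + 1.
have L1 : 1 < L by rewrite /L ltr_pwDr// le_max lexx orbT.
have LM : M < L by rewrite /L ltr_pwDr// le_max lexx.
have hL := hM _ LM.
have L0 : 0 < L by lra.
(* If |x - y| >= 1/L then |g x - g y| <= 2 L <= 2 L^2 |x - y|. *)
exists (L + 2 * L * L) => [|x Qx]; first by rewrite addr_gt0// !mulr_gt0.
have [gx lx] := hL _ Qx; split.
  by apply: le_trans gx _; rewrite lerDl !mulr_ge0// ltW.
move=> y Qy; have [gy _] := hL _ Qy.
have [xy|xy] := ltP `|x - y| L^-1.
  by apply: le_trans (lx _ xy) _; rewrite ler_wpM2r// lerDl !mulr_ge0// ltW.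
have h1 : 1 <= L * `|x - y| by rewrite mulrC -ler_pdivrMr// mul1r.
have h2 := ler_normB (g x) (g y).
have h3 : 2 * L * 1 <= 2 * L * (L * `|x - y|) by rewrite ler_wpM2l// mulr_ge0// ltW.
have h4 : 0 <= L * `|x - y| by lra.
rewrite mulrDl -mulrA; lra.
Unshelve. all: by end_near.
Qed.

(** By the mean value theorem the error of the linear approximation is the inner
    product of [y - x] with a gradient increment of norm at most K |y - x|; the
    factor [d] is the price of pairing two vectors measured in the sup norm. *)
Lemma quadratic_upper_bound (R : realType) (d : nat) (f : 'rV[R]_d -> R) (B K : R) :
  (forall x, differentiable f x) -> 0 <= K ->
  (forall x y, `|x| <= B -> `|y| <= B ->
     `|gradient f x - gradient f y| <= K * `|x - y|) ->
  forall x y, `|x| <= B -> `|y| <= B ->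
    f y - f x <= dotv (gradient f x) (y - x) + d%:R * K * `|y - x| ^+ 2.
Proof.
move=> fd K0 lip x y xB yB.
have [c /andP[c0 c1]] := gradient_mean_value x (y - x) fd.
rewrite (addrC x (y - x)) subrK => ->.
set z := x + _.
have zB : `|z| <= B.
  have -> : z = (1 - c) *: x + c *: y by rewrite /z scalerBr scalerBl scale1r [RHS]addrAC -addrA.
  apply: le_trans (ler_normD _ _) _; rewrite !normrZ (ger0_norm c0) ger0_norm ?subr_ge0//.
  have : (1 - c) * `|x| <= (1 - c) * B by rewrite ler_wpM2l// subr_ge0.
  have : c * `|y| <= c * B by rewrite ler_wpM2l.
  lra.
rewrite -lerBlDl -dotvBl; apply: le_trans (ler_norm _) _.
apply: le_trans (normr_dotv_le _ _) _; rewrite -mulrA ler_wpM2l// expr2 mulrA ler_wpM2r//.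
apply: le_trans (lip _ _ zB xB) _.
have -> : z - x = c *: (y - x) by rewrite /z addrC addKr.
by rewrite normrZ (ger0_norm c0) ler_wpM2l// ler_piMl.
Qed.

(** * The time scale and its windows *)

Lemma gammaS (R : realType) (alpha : nat -> R) n :
  gamma alpha n.+1 = gamma alpha n + alpha n.
Proof. by rewrite /gamma big_nat_recr. Qed.

Lemma gammaB (R : realType) (alpha : nat -> R) n k : (n <= k)%N ->
  gamma alpha k - gamma alpha n = \sum_(n <= i < k) alpha i.
Proof. by move=> nk; rewrite /gamma (big_cat_nat _ nk)//= addrAC subrr add0r. Qed.

Lemma gamma_le (R : realType) (alpha : nat -> R) n k :
  (forall n, 0 < alpha n) -> (n <= k)%N -> gamma alpha n <= gamma alpha k.
Proof.
by move=> a0 nk; rewrite -subr_ge0 gammaB//; apply: sumr_ge0 => i _; exact: ltW.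
Qed.

Lemma gamma_unbounded (R : realType) (alpha : nat -> R) (A : R) :
  (forall n, 0 < alpha n) -> (\sum_(0 <= n <oo) (alpha n)%:E = +oo)%E ->
  exists n, A < gamma alpha n.
Proof.
move=> a0 aoo; apply: contrapT => /forallNP hA.
suff : (+oo <= A%:E)%E by [].
rewrite -aoo; apply: lime_le.
  by apply: is_cvg_nneseries => n _ _; rewrite lee_fin ltW.
by apply: nearW => n; rewrite sumEFin lee_fin leNgt; apply/negP; exact: hA.
Qed.

(** The maximum in the definition of [a_index] exists because the time scale is
    unbounded. *)
Lemma window_max (R : realType) (alpha : nat -> R) (n : nat) (t : R) :
  (forall n, 0 < alpha n) -> (\sum_(0 <= n <oo) (alpha n)%:E = +oo)%E ->
  0 <= t ->
  exists m, in_window alpha n t m /\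
            forall j, in_window alpha n t j -> (j <= m)%N.
Proof.
move=> a0 aoo t0.
pose P j := (n <= j)%N && (gamma alpha j - gamma alpha n <= t).
have exP : exists j, P j by exists n; rewrite /P leqnn subrr.
have [N gN] := gamma_unbounded (gamma alpha n + t) a0 aoo.
have ubP j : P j -> (j <= N)%N.
  case/andP=> _ jt; rewrite leqNgt; apply/negP => Nj.
  have := gamma_le a0 (ltnW Nj); lra.
case: (ex_maxnP exP ubP) => m /andP[nm mt] mmax; exists m; split; first by split.
by move=> j [nj jt]; apply: mmax; rewrite /P nj.
Qed.

(** The shift by one matches the strict bound k < a(n, t) in [noise_max]: a sum
    whose last index is [k] lives on the window that ends at [k.+1]. *)
Lemma lt_a_index (R : realType) (alpha : nat -> R) (n k : nat) (t : R) :
  (forall n, 0 < alpha n) -> (\sum_(0 <= n <oo) (alpha n)%:E = +oo)%E ->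
  (n <= k)%N -> gamma alpha k.+1 - gamma alpha n <= t ->
  (k < a_index alpha n t)%N.
Proof.
move=> a0 aoo nk kt.
have t0 : 0 <= t.
  by apply: le_trans kt; rewrite subr_ge0; apply: gamma_le => //; apply: leqW.
have [_] := xgetPex n (window_max n a0 aoo t0).
by apply; split => //; apply: leqW.
Qed.

(** A maximal window misses the length [t] by less than the next step size,
    which is eventually below t/2. *)
Lemma window_step (R : realType) (alpha : nat -> R) (t : R) :
  (forall n, 0 < alpha n) -> (\sum_(0 <= n <oo) (alpha n)%:E = +oo)%E ->
  alpha @ \oo --> (0 : R) -> 0 < t ->
  \forall n \near \oo, exists2 m, (n < m)%N &
    t / 2 <= gamma alpha m - gamma alpha n <= t.
Proof.
move=> a0 aoo acvg t0.
have /(cvgr0Pnorm_lt _)/(_ _ (divr_gt0 t0 (ltr0n _ 2)))[N _ hN] := acvg.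
exists N => // n /= Nn.
have [m [[nm mt] mmax]] := window_max n a0 aoo (ltW t0).
have am : alpha m < t / 2.
  by apply: le_lt_trans (ler_norm _) _; apply: hN; apply: leq_trans Nn nm.
have gm : t < gamma alpha m.+1 - gamma alpha n.
  rewrite ltNge; apply/negP => mt'.
  by have := mmax m.+1 (conj (leqW nm) mt'); rewrite ltnn.
rewrite gammaS in gm.
have tm : t / 2 <= gamma alpha m - gamma alpha n by lra.
exists m; last by rewrite tm.
rewrite ltn_neqAle nm andbT; apply/eqP => nE.
by move: tm; rewrite nE subrr => tm; clear -t0 tm; lra.
Qed.

(** * Vanishing of the noise over windows *)

(** Summation by parts, in the form of an induction on the upper bound: with
    A_k the partial sums of [v], the difference between the weighted sum and
    b_m A_m changes by (b_m - b_(m+1)) A_m at each step, so its norm is at most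
    the telescoping C (b_n - b_m). *)
Lemma abel_sum_le (R : realType) (V : normedModType R) (b : nat -> R)
  (v : nat -> V) (C : R) (n m : nat) :
  (forall i j, (n <= i)%N -> (i <= j)%N -> b j <= b i) ->
  (forall i, (n <= i)%N -> 0 <= b i) -> (n <= m)%N ->
  (forall k, (n <= k <= m)%N -> `|\sum_(n <= i < k.+1) v i| <= C) ->
  `|\sum_(n <= i < m.+1) b i *: v i| <= C * b n.
Proof.
move=> bdecr b0 nm.
pose A k := \sum_(n <= i < k.+1) v i.
pose S k := \sum_(n <= i < k.+1) b i *: v i.
rewrite -/(S m) => hA.
suff H p : (forall k, (n <= k <= n + p)%N -> `|A k| <= C) ->
    `|S (n + p)%N - b (n + p)%N *: A (n + p)%N| <= C * (b n - b (n + p)%N).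
  have mE : (n + (m - n))%N = m by rewrite subnKC.
  have := H (m - n)%N; rewrite mE => /(_ hA) h1.
  have h2 := ler_normD (S m - b m *: A m) (b m *: A m).
  rewrite subrK normrZ (ger0_norm (b0 _ nm)) in h2.
  have h3 : b m * `|A m| <= b m * C by rewrite ler_wpM2l ?b0// hA// nm leqnn.
  rewrite mulrBr (mulrC C (b m)) in h1; lra.
elim: p => [|p IH] hp.
  by rewrite addn0 /S /A !big_nat1 !subrr normr0 mulr0.
have np : (n <= n + p)%N by rewrite leq_addr.
have hIH : forall k, (n <= k <= n + p)%N -> `|A k| <= C.
  by move=> k /andP[nk kp]; apply: hp; rewrite nk addnS leqW.
have h1 := IH hIH.
have SE : S (n + p.+1)%N = S (n + p)%N + b (n + p.+1)%N *: v (n + p.+1)%N.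
  by rewrite /S addnS big_nat_recr//= leqW.
have AE : A (n + p.+1)%N = A (n + p)%N + v (n + p.+1)%N.
  by rewrite /A addnS big_nat_recr//= leqW.
rewrite SE AE scalerDr opprD addrACA subrr addr0.
set b' := b (n + p.+1)%N.
have bb : 0 <= b (n + p)%N - b' by rewrite subr_ge0; apply: bdecr; rewrite // addnS.
have -> : S (n + p)%N - b' *: A (n + p)%N =
   (S (n + p)%N - b (n + p)%N *: A (n + p)%N) + (b (n + p)%N - b') *: A (n + p)%N.
  by rewrite scalerBl addrA subrK.
apply: le_trans (ler_normD _ _) _; rewrite normrZ (ger0_norm bb).
have h2 : (b (n + p)%N - b') * `|A (n + p)%N| <= (b (n + p)%N - b') * C.
  by rewrite ler_wpM2l// hIH// np leqnn.
apply: le_trans (lerD h1 h2) _; rewrite [leRHS]mulrBr !mulrBr !mulrBl; lra.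
Qed.

Lemma limn_esup_ltey (R : realType) (u : nat -> R) :
  (limn_esup (fun n => (u n)%:E) < +oo)%E ->
  exists C, \forall n \near \oo, u n <= C.
Proof.
rewrite /limn_esup /limf_esup => /ereal_inf_lt[_ [A oA <-]] supA.
have : exists C : R, (ereal_sup [set (u n)%:E | n in A] <= C%:E)%E.
  case: (ereal_sup _) supA => [C _|//|_]; first by exists C.
  by exists 0; rewrite leNye.
move=> [C hC]; exists C; apply: filterS oA => n An.
rewrite -lee_fin; apply: le_trans hC.
by apply: ereal_sup_ubound; exists n.
Qed.

Lemma inv_gamma_powR_cvg0 (R : realType) (alpha : nat -> R) (r : R) :
  (forall n, 0 < alpha n) -> (\sum_(0 <= n <oo) (alpha n)%:E = +oo)%E ->
  0 < r -> (gamma alpha n `^ r)^-1 @[n --> \oo] --> (0 : R).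
Proof.
move=> a0 aoo r0; apply/cvgr0Pnorm_le => e e0.
have [N gN] := gamma_unbounded ((e^-1) `^ r^-1) a0 aoo.
exists N => // n /= Nn.
rewrite ger0_norm ?invr_ge0 ?powR_ge0//.
rewrite -[leRHS]invrK lef_pV2 ?posrE ?invr_gt0//; last first.
  apply: powR_gt0; apply: le_lt_trans (lt_le_trans gN (gamma_le a0 Nn)).
  exact: powR_ge0.
rewrite -[leLHS](@powRr1 _ e^-1) ?invr_ge0 ?(ltW e0)// -(mulVf (lt0r_neq0 r0)) powRrM.
apply: ge0_ler_powR; rewrite ?nnegrE ?powR_ge0 ?(ltW r0)//.
  by apply: sumr_ge0 => i _; exact: ltW.
by apply: le_trans (ltW gN) (gamma_le a0 Nn).
Qed.

(** Summation by parts with weights gamma_i^(-r) against the sums controlled by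
    [noise_max]: the unweighted sums are O(gamma_n^(-r)). *)
Lemma noise_window_small (R : realType) (d : nat) (alpha : nat -> R) (r : R)
  (w : nat -> 'rV[R]_d) :
  (forall n, 0 < alpha n) -> (\sum_(0 <= n <oo) (alpha n)%:E = +oo)%E ->
  0 < r -> (limn_esup (fun n => (noise_max alpha r w n)%:E) < +oo)%E ->
  forall e, 0 < e -> \forall n \near \oo, forall k, (n <= k)%N ->
    gamma alpha k - gamma alpha n <= 1 ->
    `|\sum_(n <= i < k) alpha i *: w i| <= e.
Proof.
move=> a0 aoo r0 /limn_esup_ltey[C0 hC0] e e0.
pose C := Num.max C0 1.
have C_gt0 : 0 < C by rewrite lt_max ltr01 orbT.
have /cvgr0Pnorm_le/(_ _ (divr_gt0 e0 C_gt0)) hb :=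
  inv_gamma_powR_cvg0 a0 aoo r0.
near=> n => k nk kn.
(* gamma_0 = 0, so the weight gamma_i^(-r) makes sense from n = 1 on only. *)
have n0 : (0 < n)%N by near: n; exact: nbhs_infty_gt.
move: nk kn; case: k => [|k].
  by rewrite leqn0 => /eqP n_eq0; rewrite n_eq0 in n0.
rewrite leq_eqVlt => /orP[/eqP <- _|]; first by rewrite big_geq// normr0 ltW.
rewrite ltnS => nk kn.
pose b i := (gamma alpha i `^ r)^-1.
have g0 i : (n <= i)%N -> 0 < gamma alpha i.
  move=> ni; apply: lt_le_trans (gamma_le a0 (leq_trans n0 ni)).
  by rewrite gammaS /gamma big_geq// add0r.
have gr0 i : (n <= i)%N -> 0 < gamma alpha i `^ r by move=> ni; rewrite powR_gt0// g0.
have -> : \sum_(n <= i < k.+1) alpha i *: w i =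
    \sum_(n <= i < k.+1) b i *: ((alpha i * gamma alpha i `^ r) *: w i).
  apply: eq_big_nat => i /andP[ni _].
  by rewrite scalerA /b mulrCA mulVf ?mulr1// lt0r_neq0// gr0.
have bE : `|b n| <= e / C by near: n.
have Cb : C * b n <= e.
  by rewrite mulrC -ler_pdivlMr//; apply: le_trans bE; exact: ler_norm.
apply: le_trans Cb; apply: abel_sum_le => //.
- move=> i j ni ij; rewrite lef_pV2 ?posrE ?gr0 ?(leq_trans ni ij)//.
  apply: ge0_ler_powR; rewrite ?nnegrE ?(ltW r0) ?(ltW (g0 _ _)) ?(leq_trans ni ij)//.
  exact: gamma_le.
- by move=> i ni; rewrite invr_ge0 ltW// gr0.
move=> j /andP[nj jk]; apply: le_trans (norm_le_enorm _) _.
have nC : noise_max alpha r w n <= C0 by near: n.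
have C0C : C0 <= C by rewrite le_max lexx.
apply: le_trans C0C; apply: le_trans nC.
apply: (le_bigmax_seq 0 j xpredT (fun k : nat => enorm (\sum_(n <= i < k.+1)
  (alpha i * (gamma alpha i `^ r)) *: w i))) => //.
rewrite mem_index_iota nj /=; apply: lt_a_index => //.
by apply: le_trans kn; rewrite lerB// gamma_le.
Unshelve. all: by end_near.
Qed.

(** * Descent over one window *)

Lemma sgd_increment (R : realType) (d : nat) (alpha : nat -> R)
  (g : 'rV[R]_d -> 'rV[R]_d) (x w : nat -> 'rV[R]_d) :
  (forall n, x n.+1 = x n - alpha n *: (g (x n) + w n)) ->
  forall n k, (n <= k)%N ->
  x k - x n + (gamma alpha k - gamma alpha n) *: g (x n) =
  (\sum_(n <= i < k) alpha i *: (g (x n) - g (x i))) -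
  \sum_(n <= i < k) alpha i *: w i.
Proof.
move=> xrec n k nk; rewrite gammaB// -(telescope_sumr _ nk) scaler_suml.
rewrite -big_split -sumrB; apply: eq_bigr => i _ /=.
rewrite xrec [x i - _ - _]addrAC subrr sub0r -scalerN -scalerDr -scalerBr.
by rewrite opprD addrC addrA.
Qed.

Lemma sgd_drift (R : realType) (d : nat) (alpha : nat -> R)
  (g : 'rV[R]_d -> 'rV[R]_d) (x w : nat -> 'rV[R]_d) (K e D : R) (n k : nat) :
  (forall n, 0 < alpha n) -> 0 <= K ->
  (forall n, x n.+1 = x n - alpha n *: (g (x n) + w n)) ->
  (forall i j, `|g (x i) - g (x j)| <= K * `|x i - x j|) ->
  (n <= k)%N -> `|\sum_(n <= i < k) alpha i *: w i| <= e ->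
  (forall i, (n <= i < k)%N -> `|x i - x n| <= D) ->
  `|x k - x n + (gamma alpha k - gamma alpha n) *: g (x n)| <=
  (gamma alpha k - gamma alpha n) * (K * D) + e.
Proof.
move=> a0 K0 xrec lip nk we xD; rewrite (sgd_increment xrec)//.
apply: le_trans (ler_normB _ _) _; rewrite lerD// gammaB// mulr_suml.
apply: le_trans (ler_norm_sum _ _ _) _; rewrite !big_seq; apply: ler_sum => i.
rewrite mem_index_iota => ni; rewrite normrZ gtr0_norm// ler_wpM2l ?(ltW (a0 _))//.
by apply: le_trans (lip _ _) _; rewrite ler_wpM2l// distrC xD.
Qed.

(** A Gronwall estimate without exponential: if the points before [j] stay within
    D of [x n], the drift bound puts [x j] within T |g (x n)| + e + T K D, and
    K T <= 1/2 makes this at most D for D = 2 (T |g (x n)| + e). *)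
Lemma sgd_displacement (R : realType) (d : nat) (alpha : nat -> R)
  (g : 'rV[R]_d -> 'rV[R]_d) (x w : nat -> 'rV[R]_d) (K e : R) (n k : nat) :
  (forall n, 0 < alpha n) -> 0 <= K ->
  (forall n, x n.+1 = x n - alpha n *: (g (x n) + w n)) ->
  (forall i j, `|g (x i) - g (x j)| <= K * `|x i - x j|) ->
  K * (gamma alpha k - gamma alpha n) <= 1 / 2 ->
  (forall j, (n <= j <= k)%N -> `|\sum_(n <= i < j) alpha i *: w i| <= e) ->
  forall j, (n <= j <= k)%N ->
  `|x j - x n| <= 2 * ((gamma alpha k - gamma alpha n) * `|g (x n)| + e).
Proof.
move=> a0 K0 xrec lip; set T := _ - _ => KT we.
set D := 2 * _; elim/ltn_ind => j IH /andP[nj jk].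
have dr := @sgd_drift _ _ _ _ _ _ K e D n j a0 K0 xrec lip nj.
have {dr} := dr (we _ _) _; rewrite nj jk => /(_ isT).
set Tj := gamma alpha j - _ => dr.
have {}dr : `|x j - x n + Tj *: g (x n)| <= Tj * (K * D) + e.
  apply: dr => i /andP[ni ij]; apply: IH => //.
  by rewrite ni (leq_trans (ltnW ij)).
have Tj0 : 0 <= Tj by rewrite subr_ge0 gamma_le.
have TjT : Tj <= T by rewrite lerB// gamma_le.
have h1 := ler_normB (x j - x n + Tj *: g (x n)) (Tj *: g (x n)).
rewrite addrK normrZ (ger0_norm Tj0) in h1.
have e0 : 0 <= e by apply: le_trans (we j _); rewrite ?nj.
have h2 : Tj * `|g (x n)| <= T * `|g (x n)| by rewrite ler_wpM2r.
have D0 : 0 <= D by rewrite mulr_ge0// addr_ge0// mulr_ge0// (le_trans Tj0).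
have h3 : Tj * (K * D) <= T * (K * D) by rewrite ler_wpM2r// mulr_ge0.
have h4 : T * (K * D) <= 1 / 2 * D by rewrite mulrA (mulrC T) ler_wpM2r.
have DE : D = 2 * (T * `|g (x n)| + e) by [].
lra.
Qed.

(** The main term is - T |grad f (x n)|^2. The remainders are quadratic in T,
    hence absorbed by half of the main term when [10 * d%:R * K * T <= 1 / 2],
    or at most linear in the noise bound [e], because the gradient is at most [K]
    and e^2 <= e. *)
Lemma sgd_descent (R : realType) (d : nat) (alpha : nat -> R)
  (f : 'rV[R]_d -> R) (x w : nat -> 'rV[R]_d) (K e : R) (n k : nat) :
  (forall n, 0 < alpha n) -> 0 <= K -> e <= 1 ->
  (forall n, x n.+1 = x n - alpha n *: (gradient f (x n) + w n)) ->
  (forall i j, `|gradient f (x i) - gradient f (x j)| <= K * `|x i - x j|) ->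
  (forall i, `|gradient f (x i)| <= K) ->
  (forall i j, f (x j) - f (x i) <=
     dotv (gradient f (x i)) (x j - x i) + d%:R * K * `|x j - x i| ^+ 2) ->
  (n <= k)%N ->
  K * (gamma alpha k - gamma alpha n) <= 1 / 2 ->
  10 * d%:R * K * (gamma alpha k - gamma alpha n) <= 1 / 2 ->
  (forall j, (n <= j <= k)%N -> `|\sum_(n <= i < j) alpha i *: w i| <= e) ->
  f (x k) <= f (x n) - (gamma alpha k - gamma alpha n) / 2 *
      dotv (gradient f (x n)) (gradient f (x n)) + 10 * d%:R * K * e.
Proof.
move=> a0 K0 e1 xrec lip gK quad nk.
have T0 : 0 <= gamma alpha k - gamma alpha n by rewrite subr_ge0 gamma_le.
have disp := sgd_displacement a0 K0 xrec lip.
have drift := sgd_drift a0 K0 xrec lip nk.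
move: T0 disp drift; set T := _ - _ => T0 disp drift KT dKT we.
have {}disp := disp _ _ _ KT we.
set D := 2 * _ in disp.
have e0 : 0 <= e by apply: le_trans (we n _); rewrite ?leqnn.
have {}drift : `|x k - x n + T *: gradient f (x n)| <= T * (K * D) + e.
  apply: drift; first by apply: we; rewrite nk leqnn.
  by move=> i /andP[ni ik]; apply: disp; rewrite ni ltnW.
have {}disp : `|x k - x n| <= D by apply: disp; rewrite nk leqnn.
have {quad} := quad n k.
have := norm_sqr_le_dotv (gradient f (x n)).
have := gK n.
have -> : dotv (gradient f (x n)) (x k - x n) =
    dotv (gradient f (x n)) (x k - x n + T *: gradient f (x n))
    - T * dotv (gradient f (x n)) (gradient f (x n)).
  by rewrite [in RHS]dotvDr [in RHS]dotvZr addrK.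
have := normr_dotv_le (gradient f (x n)) (x k - x n + T *: gradient f (x n)).
set u := `|gradient f (x n)| in D disp drift *; set q := dotv _ (gradient f _).
set p := dotv _ _.
have u0 : 0 <= u := normr_ge0 _.
have d0 : 0 <= d%:R :> R by [].
set c := d%:R in d0 dKT *.
move=> pb uK uq quad.
have D0 : 0 <= D by apply: le_trans disp.
have pb' : p <= c * (u * (T * (K * D) + e)).
  apply: le_trans (ler_norm _) _; apply: le_trans pb _.
  by rewrite ler_wpM2l// ler_wpM2l.
have sqD : `|x k - x n| ^+ 2 <= D ^+ 2 by rewrite ler_sqr ?nnegrE.
have cK0 : 0 <= c * K by rewrite mulr_ge0.
have h1 : c * K * `|x k - x n| ^+ 2 <= c * K * D ^+ 2 by rewrite ler_wpM2l.
have DE : D = 2 * (T * u + e) by [].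
have TuK : T * K * u <= 1 / 2 * K.
  by rewrite (mulrC T); apply: ler_pM => //; rewrite mulr_ge0.
(* It remains to collect the coefficients: 2 + 8 = 10 for T^2 q, and
   1 + 1 + 8 = 10 for e. *)
have h2 : 2 * c * e * (T * K * u) <= 2 * c * e * (1 / 2 * K).
  by rewrite ler_wpM2l// !mulr_ge0.
have h3 : c * e * u <= c * e * K by rewrite ler_wpM2l// mulr_ge0.
have h4 : D ^+ 2 <= 8 * (T ^+ 2 * u ^+ 2 + e ^+ 2).
  have := sqr_ge0 (T * u - e); rewrite DE; lra.
have h5 : e ^+ 2 <= e by rewrite expr2 ler_piMl.
have h6 : T ^+ 2 * u ^+ 2 <= T ^+ 2 * q by rewrite ler_wpM2l// sqr_ge0.
have h7 : c * K * D ^+ 2 <= c * K * (8 * (T ^+ 2 * q + e)).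
  by rewrite ler_wpM2l//; lra.
have h8 : c * K * (T ^+ 2 * u ^+ 2) <= c * K * (T ^+ 2 * q) by rewrite ler_wpM2l.
have q0 : 0 <= q by apply: le_trans uq; rewrite sqr_ge0.
have h9 : 10 * c * K * T * (T * q) <= 1 / 2 * (T * q) by rewrite ler_wpM2r// mulr_ge0.
rewrite DE in pb'.
have h10 : p <= 2 * (c * K * (T ^+ 2 * u ^+ 2)) + 2 * c * e * (T * K * u) + c * e * u.
  by apply: le_trans pb' _; rewrite le_eqVlt; apply/orP; left; apply/eqP; ring.
clear - quad h1 h2 h3 h7 h8 h9 h10.
lra.
Qed.

(** * Consequences of the descent inequality *)

(** Suppose [u] is at most a + eta at the start of a window. At the end of a
    window of length about t it is again at most a + eta: below a + eta/2
    because one window raises [u] by at most e <= eta/2, and inside the band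
    because the decrease t/4 c outweighs e. Chaining windows, and allowing
    another e inside the last one, keeps [u] below a + 2 eta for ever. *)
Lemma eventually_below (R : realType) (gam u q : nat -> R) (t a eta c : R) :
  0 < t -> 0 < eta -> 0 < c ->
  (\forall n \near \oo, exists2 m, (n < m)%N & t / 2 <= gam m - gam n <= t) ->
  {homo gam : m n / (m <= n)%N >-> m <= n} ->
  (forall e, 0 < e -> \forall n \near \oo, forall k, (n <= k)%N ->
     gam k - gam n <= t -> u k <= u n - (gam k - gam n) / 2 * q n + e) ->
  (forall n, 0 <= q n) ->
  (forall n, a + eta / 2 <= u n <= a + eta -> c <= q n) ->
  (forall N, exists2 n, (N <= n)%N & u n < a + eta / 2) ->
  \forall n \near \oo, u n <= a + 2 * eta.
Proof.
move=> t0 eta0 c0 [N1 _ step] gle desc q0 band freq.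
pose e := Num.min (eta / 2) (t / 4 * c).
have e0 : 0 < e by rewrite lt_min !mulr_gt0.
have e1 : e <= eta / 2 by rewrite ge_min lexx.
have e2 : e <= t / 4 * c by rewrite ge_min lexx orbT.
have [N2 _ {}desc] := desc _ e0.
have [n0 Nn0 un0] := freq (N1 + N2)%N.
(* Induction on the distance to [k], jumping from window to window. *)
have H s : forall m, (n0 <= m)%N -> u m <= a + eta ->
    forall k, (m <= k <= m + s)%N -> u k <= a + 2 * eta.
  elim: s => [|s IH] m n0m um k /andP[mk ks].
    have -> : k = m by apply/eqP; rewrite eqn_leq mk andbT -(addn0 m).
    lra.
  have N1m : (N1 <= m)%N.
    by apply: leq_trans n0m; apply: leq_trans Nn0; exact: leq_addr.
  have N2m : (N2 <= m)%N.
    by apply: leq_trans n0m; apply: leq_trans Nn0; exact: leq_addl.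
  have [m' mm' /andP[tm' m't]] := step _ N1m.
  have [km'|m'k] := leqP k m'.
    have kt : gam k - gam m <= t by apply: le_trans m't; rewrite lerB// gle.
    have := desc _ N2m _ mk kt.
    have : 0 <= (gam k - gam m) / 2 * q m.
      by rewrite mulr_ge0// divr_ge0// subr_ge0 gle.
    lra.
  have um' : u m' <= a + eta.
    have hd := desc _ N2m _ (ltnW mm') m't.
    have [um2|um2] := ltP (u m) (a + eta / 2).
      have : 0 <= (gam m' - gam m) / 2 * q m.
        by rewrite mulr_ge0// divr_ge0// subr_ge0 gle// ltnW.
      lra.
    have cq : c <= q m by apply: band; rewrite um2 um.
    have : t / 4 * c <= (gam m' - gam m) / 2 * q m.
      by apply: ler_pM => //; lra.
    lra.
  apply: (IH m') => //; first by apply: leq_trans n0m (ltnW mm').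
  rewrite (ltnW m'k) /=; apply: leq_trans ks _.
  by rewrite addnS -addSn leq_add2r.
exists n0 => // k /= n0k; apply: (H (k - n0)%N n0) => //; first by lra.
by rewrite subnKC// n0k leqnn.
Qed.

(** Over a window of length at least t/2 the descent inequality bounds t/4 q n by
    the variation of [u] plus an arbitrarily small error. *)
Lemma gradient_sqr_cvg0 (R : realType) (gam u q : nat -> R) (t a : R) :
  0 < t ->
  (\forall n \near \oo, exists2 m, (n < m)%N & t / 2 <= gam m - gam n <= t) ->
  (forall e, 0 < e -> \forall n \near \oo, forall k, (n <= k)%N ->
     gam k - gam n <= t -> u k <= u n - (gam k - gam n) / 2 * q n + e) ->
  (forall n, 0 <= q n) -> u @ \oo --> a ->
  forall e, 0 < e -> \forall n \near \oo, q n <= e.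
Proof.
move=> t0 [N1 _ step] desc q0 ua e e0.
(* Three errors of size e' = t e / 12: two for the values of [u] at the ends of
   the window and one from the descent inequality. *)
pose e' := t * e / 12.
have e'0 : 0 < e' by rewrite divr_gt0// mulr_gt0.
have [N2 _ {}desc] := desc _ e'0.
have /(cvgrPdist_lt _)/(_ _ e'0)[N3 _ {}ua] := ua.
exists (N1 + N2 + N3)%N => // n /= Nn.
have N1n : (N1 <= n)%N by apply: leq_trans Nn; rewrite -addnA leq_addr.
have N2n : (N2 <= n)%N by apply: leq_trans Nn; rewrite addnAC leq_addl.
have N3n : (N3 <= n)%N by apply: leq_trans Nn; rewrite leq_addl.
have [m nm /andP[tm mt]] := step _ N1n.
have hd := desc _ N2n _ (ltnW nm) mt.
have := ua _ N3n; have := ua _ (leq_trans N3n (ltnW nm)).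
rewrite !ltr_norml => /andP[u1 u2] /andP[u3 u4].
have h : t / 4 * q n <= (gam m - gam n) / 2 * q n by rewrite ler_wpM2r//; lra.
have h2 : t / 4 * q n <= t / 4 * e by rewrite /e' in hd u1 u2 u3 u4; lra.
by rewrite ler_pM2l// in h2; rewrite divr_gt0.
Qed.

(** * Convergence along one trajectory *)

Lemma compact_norm_le (R : realType) (d : nat) (B : R) :
  compact [set y : 'rV[R]_d | `|y| <= B].
Proof.
have -> : [set y : 'rV[R]_d | `|y| <= B] = closed_ball_ Num.norm 0 B.
  by apply/funext => y; rewrite /closed_ball_ /= sub0r normrN.
apply: bounded_closed_compact; last exact: closed_closed_ball_.
exists B; split; first exact: num_real.
move=> M BM y; rewrite /closed_ball_ /= sub0r normrN => yB.
exact: le_trans yB (ltW BM).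
Qed.

(** A comparison of any two cluster values in one direction suffices, since the
    roles of the two can be exchanged. *)
Lemma cvg_compact_unique_cluster (R : realType) (u : nat -> R) (S : set R) :
  compact S -> (forall n, S (u n)) ->
  (forall a b, S a -> S b -> cluster (u @ \oo) a -> cluster (u @ \oo) b ->
     b <= a) ->
  exists a : R, u @ \oo --> a.
Proof.
move=> cS Su le_cluster.
have FS : ((u @ \oo) : set_system R) S by exists 0%N => // n _; exact: Su.
have [a [Sa ca]] := cS (u @ \oo) (fmap_proper_filter u _) FS.
have clS b : cluster (u @ \oo) b -> S b.
  move=> cb; apply: (compact_closed _ cS); first exact: Rhausdorff.
  by move=> B nB; exact: cb.
exists a.
have /compact_bounded[M [_ hM]] := cS.
have {}hM : forall y, S y -> `|y| <= M + 1.
  by apply: hM; rewrite ltrDl.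
apply: (@compact_cluster_set1 _ a _ `[- (M + 2), M + 2]%classic).
- exact: Rhausdorff.
- exact: segment_compact.
- apply/nbhs_ballP; exists 1 => //= y; rewrite -ball_normE/= in_itv/=.
  by have := hM _ Sa; rewrite -ler_norml => h1 h2; have := ler_distD a y 0;
     rewrite !subr0 (distrC y); lra.
- by exists 0%N => // n _; have := hM _ (Su n); rewrite /= in_itv/= -ler_norml; lra.
- apply/seteqP; split => b /=; last by move=> ->.
  by move=> cb; apply/eqP; rewrite eq_le !le_cluster//; exact: clS.
Qed.

(** As the exponent is at least 1, either the gradient has norm at least 1 or the
    inequality remains true with exponent 1. *)
Lemma lojasiewicz_gradient_bound (R : realType) (d : nat) (g : 'rV[R]_d)
  (y mu M eta : R) : 1 < mu -> 1 <= M -> 0 < eta ->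
  eta <= y -> y <= M * enorm g `^ mu ->
  Num.min 1 (eta / M) ^+ 2 <= dotv g g.
Proof.
move=> mu1 M1 eta0 etay yM; rewrite -enorm_sqr.
have M0 : 0 < M by lra.
have g0 : 0 <= enorm g := sqrtr_ge0 _.
rewrite ler_sqr ?nnegrE ?le_min ?ler01 ?divr_ge0 ?(ltW M0) ?(ltW eta0)//.
rewrite ge_min; have [//|g1] := lerP 1 (enorm g); apply/orP; right.
rewrite ler_pdivrMr// mulrC.
apply: le_trans etay _; apply: le_trans yM _; rewrite ler_wpM2l ?(ltW M0)//.
have [gp|gn] := ltP 0 (enorm g); first by apply: ge1r_powR; rewrite ?gp ltW.
have -> : enorm g = 0 by apply/eqP; rewrite eq_le gn g0.
by rewrite powR0// lt0r_neq0//; lra.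
Qed.

Lemma sgd_window_descent (R : realType) (d : nat) (f : 'rV[R]_d -> R)
  (alpha : nat -> R) (x w : nat -> 'rV[R]_d) (B : R) :
  (forall x, differentiable f x) -> locally_lipschitz (gradient f) ->
  (forall n, 0 < alpha n) ->
  (forall n, x n.+1 = x n - alpha n *: (gradient f (x n) + w n)) ->
  (forall n, `|x n| <= B) ->
  (forall e, 0 < e -> \forall n \near \oo, forall k, (n <= k)%N ->
    gamma alpha k - gamma alpha n <= 1 ->
    `|\sum_(n <= i < k) alpha i *: w i| <= e) ->
  exists2 t : R, 0 < t & forall e, 0 < e -> \forall n \near \oo, forall k,
    (n <= k)%N -> gamma alpha k - gamma alpha n <= t ->
    f (x k) <= f (x n) - (gamma alpha k - gamma alpha n) / 2 *
      dotv (gradient f (x n)) (gradient f (x n)) + e.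
Proof.
move=> fd gl a0 xrec xB noise.
have cQ := @compact_norm_le R d B.
have [K K0 hK] := compact_lipschitz cQ gl.
have gK n : `|gradient f (x n)| <= K := (hK _ (xB n)).1.
have lip i j : `|gradient f (x i) - gradient f (x j)| <= K * `|x i - x j|.
  exact: (hK _ (xB i)).2 (xB j).
have lipB y z : `|y| <= B -> `|z| <= B ->
    `|gradient f y - gradient f z| <= K * `|y - z|.
  by move=> yB; exact: (hK _ yB).2.
have quad i j := quadratic_upper_bound fd (ltW K0) lipB (xB i) (xB j).
pose c := 10 * d%:R * K.
have c0 : 0 <= c by rewrite !mulr_ge0// ltW.
(* T <= 1/s guarantees at once K T <= 1/2, c T <= 1/2 and T <= 1, the length up
   to which the noise is controlled. *)
pose s := 2 * (K + c + 1).
have s0 : 0 < s by rewrite mulr_gt0//; lra.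
have st T : T <= s^-1 -> 0 <= T -> [/\ K * T <= 1 / 2, c * T <= 1 / 2 & T <= 1].
  move=> Ts T0.
  have : s * T <= 1 by rewrite mulrC -ler_pdivlMr// mul1r.
  have : 0 <= K * T by rewrite mulr_ge0// ltW.
  have : 0 <= c * T by rewrite mulr_ge0.
  by rewrite /s !mulrDr !mulrDl; split; lra.
exists s^-1; first by rewrite invr_gt0.
move=> e e0.
pose e' := Num.min 1 (e / (c + 1)).
have e'0 : 0 < e' by rewrite lt_min ltr01 divr_gt0//; lra.
have ce : c * e' <= e.
  have : e' <= e / (c + 1) by rewrite ge_min lexx orbT.
  rewrite ler_pdivlMr; last by lra.
  rewrite mulrDr mulr1 (mulrC c); lra.
apply: filterS (noise _ e'0) => n hn k nk kt.
have T0 : 0 <= gamma alpha k - gamma alpha n by rewrite subr_ge0 gamma_le.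
have [KT cT T1] := st _ kt T0.
have e'1 : e' <= 1 by rewrite ge_min lexx.
have we j : (n <= j <= k)%N -> `|\sum_(n <= i < j) alpha i *: w i| <= e'.
  move=> /andP[nj jk]; apply: hn => //; apply: le_trans T1.
  by rewrite lerB// gamma_le.
have := sgd_descent a0 (ltW K0) e'1 xrec lip gK quad nk KT cT we.
rewrite -/c; lra.
Qed.

(** The values f (x n) stay in the compact image of a ball. For a cluster value a
    the Lojasiewicz inequality at a provides the band for [eventually_below], so
    that a dominates every other cluster value. *)
Lemma sgd_convergence (R : realType) (d : nat) (f : 'rV[R]_d -> R)
  (alpha : nat -> R) (x w : nat -> 'rV[R]_d) (B : R) :
  (forall x, differentiable f x) -> locally_lipschitz (gradient f) ->
  (forall n, 0 < alpha n) -> alpha @ \oo --> (0 : R) ->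
  (\sum_(0 <= n <oo) (alpha n)%:E = +oo)%E ->
  (forall n, x n.+1 = x n - alpha n *: (gradient f (x n) + w n)) ->
  (forall n, `|x n| <= B) ->
  (forall e, 0 < e -> \forall n \near \oo, forall k, (n <= k)%N ->
    gamma alpha k - gamma alpha n <= 1 ->
    `|\sum_(n <= i < k) alpha i *: w i| <= e) ->
  (forall (Q : set 'rV[R]_d) (a : R), compact Q -> (f @` Q) a ->
     exists delta mu M : R,
       [/\ 0 < delta < 1, 1 < mu <= 2, 1 <= M &
           forall x, Q x -> `|f x - a| <= delta ->
             `|f x - a| <= M * enorm (gradient f x) `^ mu]) ->
  gradient f (x n) @[n --> \oo] --> (0 : 'rV[R]_d) /\
  exists a : R, f (x n) @[n --> \oo] --> a.
Proof.
move=> fd gl a0 acvg aoo xrec xB noise loja.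
have [t t0 desc] := sgd_window_descent fd gl a0 xrec xB noise.
have step := window_step a0 aoo acvg t0.
pose Q : set 'rV[R]_d := [set y | `|y| <= B].
have cQ : compact Q := @compact_norm_le R d B.
have cfQ : compact (f @` Q).
  apply: continuous_compact => //; apply: continuous_subspaceT => y.
  exact: differentiable_continuous.
pose u n := f (x n).
pose q n := dotv (gradient f (x n)) (gradient f (x n)).
have q0 n : 0 <= q n := dotv_self_ge0 _.
have [a ua] : exists a : R, u @ \oo --> a.
  apply: (@cvg_compact_unique_cluster _ _ _ cfQ) => [n|a b Qa Qb ca cb].
    by exists (x n) => //; exact: xB.
  have [delta [mu [M [/andP[delta0 delta1] /andP[mu1 mu2] M1 hM]]]] :=
    loja _ _ cQ Qa.
  have below eta : 0 < eta -> eta <= delta ->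
      \forall n \near \oo, u n <= a + 2 * eta.
    move=> eta0 etad.
    have M0 : 0 < M by lra.
    pose c := Num.min 1 (eta / 2 / M) ^+ 2.
    apply: (@eventually_below R (gamma alpha) u q t a eta c) => //.
    - by rewrite /c exprn_gt0// lt_min ltr01 !divr_gt0.
    - by move=> m n mn; exact: gamma_le.
    - move=> n /andP[un1 un2].
      have ua_abs : `|u n - a| = u n - a by rewrite ger0_norm//; lra.
      apply: (@lojasiewicz_gradient_bound _ _ _ (u n - a) mu M) => //.
      + by rewrite divr_gt0.
      + lra.
      + by rewrite -ua_abs; apply: hM; [exact: xB|rewrite -/(u n) ua_abs; lra].
    - move=> N.
      have /(_ (u @` [set n | (N <= n)%N]) (ball a (eta / 2))) := ca.
      case=> [||y [[n Nn <-]]].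
      + by exists N => // n Nn; exists n.
      + by apply: nbhsx_ballx; rewrite divr_gt0.
      + rewrite -ball_normE/= ltr_norml => /andP[h1 h2].
        by exists n => //; lra.
  apply/ler_addgt0Pr => e e0.
  pose eta := Num.min delta (e / 4).
  have eta0 : 0 < eta by rewrite lt_min delta0 divr_gt0.
  have etad : eta <= delta by rewrite ge_min lexx.
  have etae : eta <= e / 4 by rewrite ge_min lexx orbT.
  have [N _ hN] := below _ eta0 etad.
  have /(_ (u @` [set n | (N <= n)%N]) (ball b eta)) := cb.
  case=> [||y [[n Nn <-]]].
  - by exists N => // n Nn; exists n.
  - exact: nbhsx_ballx.
  - rewrite -ball_normE/= ltr_norml => /andP[h1 h2].
    have := hN _ Nn; lra.
split; last by exists a.
apply/cvgr0Pnorm_le => e e0.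
have e20 : 0 < e ^+ 2 by rewrite exprn_gt0.
apply: filterS (gradient_sqr_cvg0 t0 step desc q0 ua e20) => n qn.
rewrite -ler_sqr ?nnegrE ?(ltW e0)//.
exact: le_trans (norm_sqr_le_dotv _) qn.
Qed.

(** * The almost sure statement *)

Unset Implicit Arguments.

Theorem theorem2p1 (R : realType) (d : nat) (f : 'rV[R]_d -> R)
  (f_diff : forall x, differentiable f x)
  (grad_lip : locally_lipschitz (gradient f))
  (alpha : nat -> R) (alpha_gt0 : forall n, 0 < alpha n)
  (disp : measure_display) (Omega : measurableType disp)
  (P : probability Omega R)
  (theta w : nat -> Omega -> 'rV[R]_d)
  (theta0_rv : random_vector (theta 0%N))
  (w_rv : forall n, random_vector (w n))
  (theta_rec : forall n omega,
     theta n.+1 omega =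
     theta n omega - alpha n *: (gradient f (theta n omega) + w n omega)) :
  let Lambda : set Omega :=
    [set omega | (ereal_sup (range (fun n => (enorm (theta n omega))%:E))
                  < +oo)%E] in
  alpha @ \oo --> (0 : R) ->
  (\sum_(0 <= n <oo) (alpha n)%:E = +oo)%E ->
  (exists2 r : R, 0 < r &
     {ae P, forall omega, Lambda omega ->
        (limn_esup (fun n => (noise_max alpha r (fun i => w i omega) n)%:E)
         < +oo)%E}) ->
  (forall (Q : set 'rV[R]_d) (a : R), compact Q -> (f @` Q) a ->
     exists delta mu M : R,
       [/\ 0 < delta < 1, 1 < mu <= 2, 1 <= M &
           forall x, Q x -> `|f x - a| <= delta ->
             `|f x - a| <= M * enorm (gradient f x) `^ mu]) ->
  {ae P, forall omega, Lambda omega ->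
     gradient f (theta n omega) @[n --> \oo] --> (0 : 'rV[R]_d) /\
     f (theta n omega) @[n --> \oo] --> limn_inf (fun n => f (theta n omega))}.
Proof.
move=> Lambda acvg aoo [r r0 noise] loja.
apply: filterS noise => omega noise Lomega.
have {}noise := noise Lomega.
have [B hB] : exists B, forall n, `|theta n omega| <= B.
  move: Lomega; rewrite /Lambda /=.
  have ub n : ((enorm (theta n omega))%:E <=
      ereal_sup (range (fun n => (enorm (theta n omega))%:E)))%E.
    by apply: ereal_sup_ubound; exists n.
  case: (ereal_sup _) ub => [B ub _|//|ub _]; last by have := ub 0%N.
  exists B => n; apply: le_trans (norm_le_enorm _) _.
  by rewrite -lee_fin; exact: ub.
have [gcvg [a fcvg]] := sgd_convergence f_diff grad_lip alpha_gt0 acvg aoo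
  (fun n => theta_rec n omega) hB (noise_window_small alpha_gt0 aoo r0 noise)
  loja.
by split => //; rewrite (cvg_limn_inf_sup fcvg).1.
Qed.
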